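(* Let $i,k,r,s\ge 1$ be integers with $k\ge i$, and let $n\ge -1$ be an integer. Then $$F^{i}_{r,s}(k,n)=\sum_{j=0}^{\lfloor \frac{n+1}{k}\rfloor} r^{\lfloor \frac{n+1-jk}{i}\rfloor}\,s^{j}\binom{j+\lfloor \frac{n+1-jk}{i}\rfloor}{j}.$$
   Context: For integers $i,k,r,s\ge 1$, the sequence $F^{i}_{r,s}(k,n)$, $n\ge -1$, is defined as follows. If $i\le k$, then $F^{i}_{r,s}(k,n)=r^{\lfloor (n+1)/i\rfloor}$ for $n=-1,0,\ldots,k-2$; if $k<i$, then $F^{i}_{r,s}(k,n)=s^{\lfloor (n+1)/k\rfloor}$ for $n=-1,0,\ldots,i-2$; and for all $n\ge \max\{k,i\}-1$, $F^{i}_{r,s}(k,n)=rF^{i}_{r,s}(k,n-i)+sF^{i}_{r,s}(k,n-k)$. *)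

(* Defs.v *)
From mathcomp Require Import all_boot all_order all_algebra.
From mathcomp Require Import zify.

Set Implicit Arguments.
Unset Strict Implicit.
Unset Printing Implicit Defensive.

Import Order.TTheory GRing.Theory Num.Theory.

Local Open Scope nat_scope.

(* The value at the shifted index m = n + 1 >= 0, by recursion on a fuel
   argument; any fuel greater than m gives the same value (fib_recE). *)
Fixpoint fib_rec (fuel i r s k m : nat) : nat :=
  if fuel is f.+1 then
    if m < maxn k i then
      if i <= k then r ^ (m %/ i) else s ^ (m %/ k)
    else r * fib_rec f i r s k (m - i) + s * fib_rec f i r s k (m - k)
  else 0.

(* F^i_{r,s}(k, n) for i, k, r, s >= 1 and n >= -1 (junk for n < -1).
   The three lemmas fib_init_le, fib_init_gt and fib_step are the defining
   clauses of the sequence. *)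
Definition fib (i r s k : nat) (n : int) : nat :=
  let m := `|(n + 1)%R|%N in fib_rec m.+1 i r s k m.

Lemma fib_recE (f g i r s k m : nat) : 0 < i -> 0 < k -> m < f -> m < g ->
  fib_rec f i r s k m = fib_rec g i r s k m.
Proof.
move=> i_gt0 k_gt0; elim: f g m => [|f IHf] [|g] m //= ltmf ltmg.
case: ltnP => //; rewrite geq_max => /andP[le_km le_im].
have lt_sub d : 0 < d -> d <= m -> (m - d < f) && (m - d < g).
  by clear -ltmf ltmg; lia.
have /andP[? ?] := lt_sub _ i_gt0 le_im.
have /andP[? ?] := lt_sub _ k_gt0 le_km.
by congr (_ * _ + _ * _); apply: IHf.
Qed.

Lemma fib_init_le (i r s k : nat) (n : int) :
  0 < i -> i <= k -> (-1 <= n <= k%:Z - 2)%R ->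
  fib i r s k n = r ^ `|((n + 1)%R %/ i%:Z)%Z|%N.
Proof.
move=> i_gt0 le_ik /andP[n_ge n_le].
have [m Dm] : exists m : nat, (n + 1 = m%:Z)%R by exists `|(n + 1)%R|%N; lia.
have lt_mk : m < k by clear -Dm n_le; lia.
by rewrite /fib Dm absz_nat /= leq_max lt_mk le_ik divz_nat absz_nat.
Qed.

Lemma fib_init_gt (i r s k : nat) (n : int) :
  0 < k -> k < i -> (-1 <= n <= i%:Z - 2)%R ->
  fib i r s k n = s ^ `|((n + 1)%R %/ k%:Z)%Z|%N.
Proof.
move=> k_gt0 lt_ki /andP[n_ge n_le].
have [m Dm] : exists m : nat, (n + 1 = m%:Z)%R by exists `|(n + 1)%R|%N; lia.
have lt_mi : m < i by clear -Dm n_le; lia.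
by rewrite /fib Dm absz_nat /= leq_max lt_mi orbT leqNgt lt_ki divz_nat absz_nat.
Qed.

Lemma fib_step (i r s k : nat) (n : int) :
  0 < i -> 0 < k -> ((maxn k i)%:Z - 1 <= n)%R ->
  fib i r s k n = r * fib i r s k (n - i%:Z)%R + s * fib i r s k (n - k%:Z)%R.
Proof.
move=> i_gt0 k_gt0 n_ge.
have [m Dm] : exists m : nat, (n + 1 = m%:Z)%R by exists `|(n + 1)%R|%N; lia.
have Di : `|(n - i%:Z + 1)%R|%N = m - i by lia.
have Dk : `|(n - k%:Z + 1)%R|%N = m - k by lia.
rewrite /fib Dm absz_nat Di Dk [fib_rec m.+1 _ _ _ _ _]/=.
have -> : m < maxn k i = false by lia.
by congr (_ * _ + _ * _); apply: fib_recE; lia.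
Qed.

(* Main.v *)
(* The closed form satisfies the recurrence term by term: with
   q = floor ((m - (j+1)k) / i), the (j+1)-st term splits by Pascal's rule,
   the summand with 'C(j + q, j + 1) being r times the term of index j+1 at
   m - i, and the one with 'C(j + q, j) being s times the term of index j at
   m - k.  If q = 0, the first summand vanishes, in accordance with the
   shorter range of summation at m - i. *)
Require Import Defs.
From mathcomp Require Import all_boot all_order all_algebra.
From mathcomp Require Import zify.

Set Implicit Arguments.
Unset Strict Implicit.
Unset Printing Implicit Defensive.

Import Order.TTheory GRing.Theory Num.Theory.

Local Open Scope nat_scope.

(* Vanishes for [m < j * k], so that sums of [term] do not depend on their upper
   bound once it exceeds [m %/ k]. *)
Definition term (i r s k m j : nat) : nat :=
  if j * k <= m then
    r ^ ((m - j * k) %/ i) * s ^ j * 'C(j + (m - j * k) %/ i, j)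
  else 0.

Lemma divn_subS (i m : nat) : 0 < i -> i <= m -> m %/ i = ((m - i) %/ i).+1.
Proof.
by move=> i_gt0 le_im; rewrite -{1}(subnK le_im) divnDr // divnn i_gt0 addn1.
Qed.

Lemma term0_step (i r s k m : nat) : 0 < i -> i <= m ->
  term i r s k m 0 = r * term i r s k (m - i) 0.
Proof.
move=> i_gt0 le_im; rewrite /term !mul0n !leq0n !subn0 !bin0 !muln1.
by rewrite (divn_subS i_gt0 le_im) expnS.
Qed.

Lemma termS_step (i r s k m j : nat) : 0 < i -> i <= m -> k <= m ->
  term i r s k m j.+1 =
  r * term i r s k (m - i) j.+1 + s * term i r s k (m - k) j.
Proof.
move=> i_gt0 le_im le_km; rewrite /term.
have -> : (j * k <= m - k) = (j.+1 * k <= m) by rewrite mulSn; lia.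
have -> : m - k - j * k = m - j.+1 * k by rewrite mulSn subnDA.
have -> : m - i - j.+1 * k = m - j.+1 * k - i by rewrite subnAC.
case: (leqP (j.+1 * k) m) => [le_jm | lt_mj]; last first.
  by rewrite ifF ?muln0 //; lia.
have -> : (j.+1 * k <= m - i) = (i <= m - j.+1 * k) by clear -le_im le_jm; lia.
set p := m - _.
case: (leqP i p) => [le_ip | lt_pi].
  (* Here [q] is the quotient at [m - i], so [p %/ i] is [q.+1]. *)
  rewrite (divn_subS i_gt0 le_ip); set q := _ %/ i.
  rewrite addnS binS mulnDr addSnnS !expnS.
  by congr (_ + _); rewrite -!mulnA //; lia.
by rewrite divn_small // !addn0 !binn expnS; lia.
Qed.

(** Lets the sum at [m - i] be taken over the possibly longer range of the sum at [m]. *)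
Lemma sum_term_widen (i r s k m N : nat) : 0 < k -> m %/ k < N ->
  \sum_(0 <= j < N) term i r s k m j =
  \sum_(0 <= j < (m %/ k).+1) term i r s k m j.
Proof.
move=> k_gt0 ltN; rewrite (big_cat_nat (n := (m %/ k).+1)) //=.
rewrite [X in _ + X]big_nat_cond [X in _ + X]big1 ?addn0 // => j.
by rewrite andbT ltn_divLR // => /andP[lt_mj _]; rewrite /term leqNgt lt_mj.
Qed.

Lemma fib_rec_sum_term (f i r s k m : nat) : 0 < i -> i <= k -> m < f ->
  fib_rec f i r s k m = \sum_(0 <= j < (m %/ k).+1) term i r s k m j.
Proof.
move=> i_gt0 le_ik; have k_gt0 := leq_trans i_gt0 le_ik.
elim: f m => // f IHf m lt_mf /=.
rewrite (maxn_idPl le_ik) le_ik; case: ltnP => [lt_mk | le_km].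
  rewrite (divn_small lt_mk) big_nat1 /term mul0n leq0n subn0 bin0.
  by rewrite !muln1.
have le_im := leq_trans le_ik le_km.
rewrite !IHf; try lia.
rewrite -(@sum_term_widen _ _ _ _ (m - i) (m %/ k).+1) //; last first.
  by rewrite ltnS leq_div2r // leq_subr.
(* Index 0 comes from [m - i] alone; index [j.+1] also receives index [j] from [m - k], whose range
   is one shorter. *)
rewrite !(big_nat_recl (m %/ k)) //= (@term0_step _ _ _ _ m) // mulnDr -addnA.
congr (_ + _); rewrite -(divn_subS k_gt0 le_km) !big_distrr -big_split /=.
by apply: eq_bigr => j _; rewrite -termS_step.
Qed.

Theorem theorem3p2 (i k r s : nat) (n : int) :
  0 < i -> 0 < k -> 0 < r -> 0 < s -> i <= k -> (-1 <= n)%R ->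
  fib i r s k n =
  \sum_(0 <= j < `|((n + 1)%R %/ k%:Z)%Z|%N.+1)
     r ^ `|((n + 1 - (j * k)%:Z)%R %/ i%:Z)%Z|%N * s ^ j *
     'C(j + `|((n + 1 - (j * k)%:Z)%R %/ i%:Z)%Z|%N, j).
Proof.
move=> i_gt0 k_gt0 _ _ le_ik n_ge.
have [m Dm] : exists m : nat, (n + 1 = m%:Z)%R by exists `|(n + 1)%R|%N; lia.
rewrite /fib Dm absz_nat fib_rec_sum_term // divz_nat absz_nat.
(* In this range [j * k <= m], so the guard in [term] holds and integer and truncated subtraction
   agree. *)
apply: eq_big_nat => j /andP[_]; rewrite ltnS leq_divRL // => le_jm.
by rewrite /term le_jm subzn // divz_nat absz_nat.
Qed.
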